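(* Let $B$ be a finite cyclic left brace (i.e. a finite left brace whose additive group is cyclic) and let $(X,r)$ be an indecomposable solution whose permutation left brace $\mathcal{G}(X,r)$ is isomorphic to $B$ as a left brace. Then $(X,r)$ is uniconnected.
   Context: A solution is a pair $(X,r)$ with $X$ a non-empty set and $r:X\times X\to X\times X$, $r(x,y)=(\sigma_x(y),\tau_y(x))$, such that $(r\times \mathrm{id})(\mathrm{id}\times r)(r\times \mathrm{id})=(\mathrm{id}\times r)(r\times \mathrm{id})(\mathrm{id}\times r)$ on $X^3$, $r^2=\mathrm{id}$ (involutive), and all maps $\sigma_x,\tau_y:X\to X$ are bijections (non-degenerate). The permutation group $\mathcal{G}(X,r)$ is the subgroup of $\mathrm{Sym}(X)$ generated by all $\sigma_x$. $(X,r)$ is indecomposable if $\mathcal{G}(X,r)$ acts transitively on $X$, and uniconnected if $\mathcal{G}(X,r)$ acts regularly on $X$. A left brace is a set $B$ with two operations $+,\circ$ such that $(B,+)$ is an abelian group, $(B,\circ)$ is a group and $a\circ(b+c)=a\circ b-a+a\circ c$ for all $a,b,c$. For $a\in B$ put $\lambda_a(b)=-a+a\circ b$. The permutation left brace of $(X,r)$ is $\mathcal{G}(X,r)$ with $\circ$ equal to composition and with the unique addition making it a left brace such that $\lambda_g(\sigma_x)=\sigma_{g(x)}$ for all $g\in\mathcal{G}(X,r)$, $x\in X$. *)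

(* Defs.v *)
From mathcomp Require Import all_boot all_algebra.

Set Implicit Arguments.
Unset Strict Implicit.
Unset Printing Implicit Defensive.

(** The underlying set [X] is arbitrary: no finiteness or decidable equality. *)

Definition map12 (X : Type) (r : X * X -> X * X) (t : X * X * X) : X * X * X :=
  let: (x, y, z) := t in let: (x', y') := r (x, y) in (x', y', z).

Definition map23 (X : Type) (r : X * X -> X * X) (t : X * X * X) : X * X * X :=
  let: (x, y, z) := t in let: (y', z') := r (y, z) in (x, y', z').

Record solution (X : Type) := Solution {
  sol_map :> X * X -> X * X;
  sol_nonempty : inhabited X;
  sol_braid : map12 sol_map \o map23 sol_map \o map12 sol_map
              =1 map23 sol_map \o map12 sol_map \o map23 sol_map;
  sol_invol : involutive sol_map;
  sol_sigma_bij : forall x, bijective (fun y => (sol_map (x, y)).1);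
  sol_tau_bij : forall y, bijective (fun x => (sol_map (x, y)).2)
}.

Definition sigma (X : Type) (r : solution X) (x y : X) : X := (r (x, y)).1.

(** The subgroup of [Sym(X)] generated by the [sigma r x], as a predicate on
    maps [X -> X]; only bijections can satisfy it. *)
Inductive in_perm_group (X : Type) (r : solution X) : (X -> X) -> Prop :=
| in_perm_group_sigma x : in_perm_group r (sigma r x)
| in_perm_group_id : in_perm_group r id
| in_perm_group_comp g h :
    in_perm_group r g -> in_perm_group r h -> in_perm_group r (g \o h)
| in_perm_group_inv g h :
    in_perm_group r g -> cancel g h -> cancel h g -> in_perm_group r h.

Definition perm_group (X : Type) (r : solution X) : Type :=
  {g : X -> X | in_perm_group r g}.

Definition perm_act (X : Type) (r : solution X) (g : perm_group r) : X -> X :=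
  sval g.

Definition perm_sigma (X : Type) (r : solution X) (x : X) : perm_group r :=
  exist _ (sigma r x) (in_perm_group_sigma r x).

Definition acts_transitively (X : Type) (r : solution X) : Prop :=
  forall x y : X, exists g : perm_group r, perm_act g x = y.

Definition acts_freely (X : Type) (r : solution X) : Prop :=
  forall (g : perm_group r) (x : X), perm_act g x = x -> perm_act g =1 id.

Definition indecomposable (X : Type) (r : solution X) : Prop :=
  acts_transitively r.

Definition uniconnected (X : Type) (r : solution X) : Prop :=
  acts_transitively r /\ acts_freely r.

(** The two group structures are unbundled over the carrier [T], so that one can
    speak of a brace structure on a given set, such as [perm_group r]. *)
Record left_brace (T : Type) := LeftBrace {
  badd : T -> T -> T;
  bzero : T;
  bopp : T -> T;
  bcirc : T -> T -> T;
  bone : T;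
  binv : T -> T;
  baddA : associative badd;
  baddC : commutative badd;
  badd0 : left_id bzero badd;
  baddN : left_inverse bzero bopp badd;
  bcircA : associative bcirc;
  bcirc1l : left_id bone bcirc;
  bcirc1r : right_id bone bcirc;
  bcircVl : left_inverse bone binv bcirc;
  bcircVr : right_inverse bone binv bcirc;
  bcircD : forall a b c,
    bcirc a (badd b c) = badd (badd (bcirc a b) (bopp a)) (bcirc a c)
}.

Definition blambda (T : Type) (B : left_brace T) (a b : T) : T :=
  badd B (bopp B a) (bcirc B a b).

Definition bmulz (T : Type) (B : left_brace T) (a : T) (k : int) : T :=
  match k with
  | Posz n => iter n (badd B a) (bzero B)
  | Negz n => bopp B (iter n.+1 (badd B a) (bzero B))
  end.

Definition cyclic_brace (T : Type) (B : left_brace T) : Prop :=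
  exists a : T, forall b : T, exists k : int, b = bmulz B a k.

Definition brace_isomorphic (T U : Type) (B : left_brace T) (C : left_brace U)
    : Prop :=
  exists f : T -> U,
    [/\ bijective f,
        {morph f : a b / badd B a b >-> badd C a b} &
        {morph f : a b / bcirc B a b >-> bcirc C a b}].

(** The two conditions determine the brace structure [P] uniquely, so this
    says that [P] is the permutation left brace of [r]. *)
Definition is_permutation_brace (X : Type) (r : solution X)
    (P : left_brace (perm_group r)) : Prop :=
  (forall g h : perm_group r,
     perm_act (bcirc P g h) =1 perm_act g \o perm_act h) /\
  (forall (g : perm_group r) (x : X),
     blambda P g (perm_sigma r x) = perm_sigma r (perm_act g x)).

(* Main.v *)
Require Import Defs.
From mathcomp Require Import all_boot all_algebra.

(** Why the theorem holds.  Write [s] for the element [sigma_x] of the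
    permutation brace [P], where [x] is any point.

    An additive endomorphism of a cyclic group is multiplication by an integer,
    so every [lambda_g] maps each [b] into the additive subgroup [<b>]
    ([cyclic_lambda_span]).  Hence every [<b>] is also a subgroup for the circle
    operation.  By transitivity all [sigma_y = lambda_g(s)], with [y = g(x)],
    lie in [<s>]; as they generate the permutation group, [<s>] is everything
    ([perm_group_span]).

    Suppose now that [g] fixes [x].  Then [lambda_g(s) = sigma_(g(x)) = s], so
    [lambda_g] is the identity on [<s>], that is, everywhere.  On the additive
    subgroup [<g>] sum and circle product therefore agree, and all elements of
    [<g>] are circle powers of [g]; they fix [x] as well
    ([span_stabilizer]).  Finally [k^-1 o g o k = lambda_(k^-1)(g)] belongs to
    [<g>] for all [k] ([circ_lambda_conj]).  So every conjugate of [g] fixes [x],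
    i.e. [g] fixes every point [k(x)], and these are all points of [X]. *)

Set Implicit Arguments.
Unset Strict Implicit.
Unset Printing Implicit Defensive.

(** * The additive group of a brace and its cyclic subgroups *)

Lemma baddr0 (T : Type) (B : left_brace T) : right_id (bzero B) (badd B).
Proof. by move=> a; rewrite baddC badd0. Qed.

Lemma baddrN (T : Type) (B : left_brace T) :
  right_inverse (bzero B) (bopp B) (badd B).
Proof. by move=> a; rewrite baddC baddN. Qed.

Lemma baddKl (T : Type) (B : left_brace T) (a : T) :
  cancel (badd B a) (badd B (bopp B a)).
Proof. by move=> b; rewrite baddA baddN badd0. Qed.

Lemma baddNKl (T : Type) (B : left_brace T) (a : T) :
  cancel (badd B (bopp B a)) (badd B a).
Proof. by move=> b; rewrite baddA baddrN badd0. Qed.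

Lemma baddI (T : Type) (B : left_brace T) (a : T) : injective (badd B a).
Proof. exact: can_inj (baddKl B a). Qed.

Lemma bopp_unique (T : Type) (B : left_brace T) (a b : T) :
  badd B a b = bzero B -> b = bopp B a.
Proof. by move=> ab0; apply: (@baddI _ B a); rewrite ab0 baddrN. Qed.

Lemma baddACA (T : Type) (B : left_brace T) : interchange (badd B) (badd B).
Proof.
move=> a b c d; rewrite -!(baddA B); congr (badd B a _).
by rewrite !(baddA B) (baddC B b).
Qed.

Section AdditiveMaps.

Context (T U : Type) (B : left_brace T) (C : left_brace U) (f : T -> U).
Hypothesis fD : {morph f : a b / badd B a b >-> badd C a b}.

Lemma additive0 : f (bzero B) = bzero C.
Proof. by apply: (@baddI _ C (f (bzero B))); rewrite -fD badd0 baddr0. Qed.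

Lemma additiveN : {morph f : a / bopp B a >-> bopp C a}.
Proof. by move=> a; apply: bopp_unique; rewrite -fD baddrN additive0. Qed.

Lemma additive_mulz k : {morph f : a / bmulz B a k >-> bmulz C a k}.
Proof.
have fMn a n : f (iter n (badd B a) (bzero B)) = iter n (badd C (f a)) (bzero C).
  by elim: n => [|n IHn]; rewrite ?additive0 // !iterS fD IHn.
by move=> a; case: k => n; rewrite /bmulz ?additiveN fMn.
Qed.

End AdditiveMaps.

Lemma bmulzDl (T : Type) (B : left_brace T) k :
  {morph (fun a => bmulz B a k) : a b / badd B a b}.
Proof.
have mulnD a b n : iter n (badd B (badd B a b)) (bzero B)
    = badd B (iter n (badd B a) (bzero B)) (iter n (badd B b) (bzero B)).
  by elim: n => [|n IHn]; rewrite ?badd0 // !iterS IHn baddACA.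
move=> a b; case: k => n; rewrite /bmulz mulnD //.
by apply/esym/bopp_unique; rewrite baddACA !baddrN badd0.
Qed.

(** The inductive presentation of the cyclic subgroup generated by [a] turns
    closure arguments into inductions that never mention an integer multiplier. *)
Inductive span (T : Type) (B : left_brace T) (a : T) : T -> Prop :=
| span_gen : span B a a
| span0 : span B a (bzero B)
| spanD b c : span B a b -> span B a c -> span B a (badd B b c)
| spanN b : span B a b -> span B a (bopp B b).

Lemma span_trans (T : Type) (B : left_brace T) (a b c : T) :
  span B a b -> span B b c -> span B a c.
Proof.
move=> ab; elim=> [|| d e _ ad _ ae | d _ ad] //.
- exact: span0.
- exact: spanD.
- exact: spanN.
Qed.

Lemma span_mulz (T : Type) (B : left_brace T) (a : T) k : span B a (bmulz B a k).
Proof.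
have spanMn n : span B a (iter n (badd B a) (bzero B)).
  by elim: n => [|n IHn]; [exact: span0 | apply: spanD IHn; exact: span_gen].
by case: k => n; [exact: spanMn | exact/spanN/spanMn].
Qed.

Lemma additive_eq_span (T : Type) (B : left_brace T) (f h : T -> T) (a b : T) :
    {morph f : c d / badd B c d} -> {morph h : c d / badd B c d} ->
  f a = h a -> span B a b -> f b = h b.
Proof.
move=> fD hD fha; elim=> [|| c d _ fhc _ fhd | c _ fhc] //.
- by rewrite (additive0 fD) (additive0 hD).
- by rewrite fD hD fhc fhd.
- by rewrite (additiveN fD) (additiveN hD) fhc.
Qed.

(** An endomorphism of a cyclic group is multiplication by an integer. *)
Lemma additive_span (T : Type) (B : left_brace T) (f : T -> T) (b : T) :
  cyclic_brace B -> {morph f : c d / badd B c d} -> span B b (f b).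
Proof.
move=> [a gen_a] fD; have [m fa] := gen_a (f a).
have ab : span B a b by have [k ->] := gen_a b; apply: span_mulz.
by rewrite (additive_eq_span fD (bmulzDl B m) fa ab); apply: span_mulz.
Qed.

Lemma isomorphic_cyclic (T U : Type) (B : left_brace T) (C : left_brace U) :
  brace_isomorphic B C -> cyclic_brace C -> cyclic_brace B.
Proof.
move=> [f [[h fK hK] fD _]] [a gen_a]; exists (h a) => b.
have [k fb] := gen_a (f b); exists k.
by apply: (can_inj fK); rewrite (additive_mulz fD) hK.
Qed.

(** * The lambda map *)

Lemma circ_lambda (T : Type) (B : left_brace T) (a b : T) :
  bcirc B a b = badd B a (blambda B a b).
Proof. by rewrite /blambda baddNKl. Qed.

Lemma lambdaD (T : Type) (B : left_brace T) (a : T) :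
  {morph blambda B a : b c / badd B b c}.
Proof.
move=> b c; rewrite /blambda bcircD !(baddA B).
by rewrite -(baddA B (badd B _ _) (bopp B a)).
Qed.

Lemma bone_zero (T : Type) (B : left_brace T) : bone B = bzero B.
Proof.
by rewrite -[RHS](bcirc1l B) circ_lambda (additive0 (lambdaD B (bone B))) baddr0.
Qed.

Lemma lambda1 (T : Type) (B : left_brace T) (b : T) : blambda B (bone B) b = b.
Proof.
by apply: (@baddI _ B (bone B)); rewrite -circ_lambda bcirc1l bone_zero badd0.
Qed.

Lemma lambdaM (T : Type) (B : left_brace T) (a b c : T) :
  blambda B (bcirc B a b) c = blambda B a (blambda B b c).
Proof.
apply: (@baddI _ B (bcirc B a b)); rewrite -circ_lambda -bcircA.
by rewrite (circ_lambda B b c) circ_lambda lambdaD baddA -circ_lambda.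
Qed.

(** When [lambda_g] fixes [k], this is the conjugation formula
    [k^-1 o g o k = lambda_(k^-1)(g)]: both products equal the sum [g + k]. *)
Lemma circ_lambda_conj (T : Type) (B : left_brace T) (g k : T) :
  blambda B g k = k ->
  bcirc B g k = bcirc B k (blambda B (binv B k) g).
Proof.
by move=> gk; rewrite !circ_lambda gk -lambdaM bcircVr lambda1 baddC.
Qed.

Lemma cyclic_lambda_span (T : Type) (B : left_brace T) (g b : T) :
  cyclic_brace B -> span B b (blambda B g b).
Proof. by move=> cycB; apply: additive_span cycB (lambdaD B g). Qed.

Lemma span_circ (T : Type) (B : left_brace T) (a b c : T) :
  cyclic_brace B -> span B a b -> span B a c -> span B a (bcirc B b c).
Proof.
move=> cycB ab ac; rewrite circ_lambda; apply: spanD ab _.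
exact: span_trans ac (cyclic_lambda_span _ _ cycB).
Qed.

Lemma span_inv (T : Type) (B : left_brace T) (a b : T) :
  cyclic_brace B -> span B a b -> span B a (binv B b).
Proof.
move=> cycB ab; have -> : binv B b = bopp B (blambda B (binv B b) b).
  by apply: bopp_unique; rewrite baddC -circ_lambda bcircVl bone_zero.
exact/spanN/(span_trans ab)/cyclic_lambda_span.
Qed.

(** * Permutation braces *)

Section PermutationBrace.

Context (X : Type) (r : solution X) (P : left_brace (perm_group r)).
Hypothesis permP : is_permutation_brace P.

Lemma perm_actM (g h : perm_group r) (x : X) :
  perm_act (bcirc P g h) x = perm_act g (perm_act h x).
Proof. by case: permP => actM _; apply: actM. Qed.

Lemma lambda_sigma (g : perm_group r) (x : X) :
  blambda P g (perm_sigma r x) = perm_sigma r (perm_act g x).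
Proof. by case: permP => _; apply. Qed.

Lemma perm_act1 (x : X) : perm_act (bone P) x = x.
Proof.
have actM1 := perm_actM (perm_sigma r x) (bone P) x.
by apply: (bij_inj (sol_sigma_bij r x)); rewrite bcirc1r in actM1.
Qed.

(** Elements of [perm_group r] carry a membership proof, so the conclusion is
    an equality of permutations rather than membership of [f] itself; this
    is all that an action can see. *)
Lemma perm_group_span (x : X) (f : X -> X) :
    cyclic_brace P -> acts_transitively r -> in_perm_group r f ->
  exists2 g, span P (perm_sigma r x) g & perm_act g =1 f.
Proof.
move=> cycP trans.
elim=> [y || f1 f2 _ [g1 xg1 def_f1] _ [g2 xg2 def_f2]
       | f1 f2 _ [g xg def_f1] f1K f2K].
- exists (perm_sigma r y) => //; have [g <-] := trans x y.
  by rewrite -lambda_sigma; apply: cyclic_lambda_span.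
- by exists (bone P); [rewrite bone_zero; apply: span0 | apply: perm_act1].
- exists (bcirc P g1 g2); first exact: span_circ.
  by move=> y; rewrite perm_actM def_f1 def_f2.
- exists (binv P g); first exact: span_inv.
  move=> y; apply: (can_inj f1K).
  by rewrite f2K -def_f1 -perm_actM bcircVr perm_act1.
Qed.

(** The two conclusions are proved together: additive closure of the
    stabilizer uses that [lambda_b] is trivial, which turns [b + c] into
    [b o c] and [- b] into [b^-1]. *)
Lemma span_stabilizer (x : X) (g b : perm_group r) :
    perm_act g x = x -> span P (perm_sigma r x) g -> span P g b ->
  perm_act b x = x /\
  forall c, span P (perm_sigma r x) c -> blambda P b c = c.
Proof.
move=> gx xg; elim=> [|| c d _ [cx lam_c] gd [dx lam_d] | c gc [cx lam_c]].
- split=> // c; apply: (additive_eq_span (h := id)) => //; first exact: lambdaD.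
  by rewrite lambda_sigma gx.
- by rewrite -bone_zero perm_act1; split=> // c _; rewrite lambda1.
- have -> : badd P c d = bcirc P c d.
    by rewrite circ_lambda lam_c //; apply: span_trans gd.
  rewrite perm_actM dx cx; split=> // e xe.
  by rewrite lambdaM lam_d // lam_c.
- have circN : bcirc P c (bopp P c) = bone P.
    rewrite circ_lambda lam_c ?baddrN ?bone_zero //.
    by apply: spanN; apply: span_trans gc.
  have -> : bopp P c = binv P c.
    by rewrite -[LHS](bcirc1l P) -(bcircVl P c) -bcircA circN bcirc1r.
  split=> [|e xe]; first by rewrite -{1}cx -perm_actM bcircVl perm_act1.
  by rewrite -{1}(lam_c e xe) -lambdaM bcircVl lambda1.
Qed.

Lemma cyclic_acts_freely :
  cyclic_brace P -> acts_transitively r -> acts_freely r.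
Proof.
move=> cycP trans h x hx y.
have [g xg act_g] := perm_group_span x cycP trans (svalP h).
have gx : perm_act g x = x by rewrite act_g.
have [k0 <-] := trans x y.
have [k xk act_k] := perm_group_span x cycP trans (svalP k0).
rewrite /perm_act -act_k -act_g -perm_actM circ_lambda_conj; last first.
  by have [_ ->] := span_stabilizer gx xg (span_gen P g).
have [fix_x _] := span_stabilizer gx xg (cyclic_lambda_span (binv P k) g cycP).
by rewrite perm_actM fix_x.
Qed.

End PermutationBrace.

Theorem theorem2p2 (B : finType) (SB : left_brace B) (hB : cyclic_brace SB)
    (X : Type) (r : solution X) (hr : indecomposable r)
    (P : left_brace (perm_group r)) (hP : is_permutation_brace P)
    (hiso : brace_isomorphic P SB) :
  uniconnected r.
Proof.
split; first exact: hr.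
exact: cyclic_acts_freely hP (isomorphic_cyclic hiso hB) hr.
Qed.
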